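(* There exist universal positive constants $C_1, C_2$ such that the following holds. Fix $m,n\in \mathbb{N}$. Let $A\in \mathbb{R}^{m\times n}$ be a matrix of rank $r = \alpha n$ for some $0 < \alpha < 1$. Suppose that $A$ is $(k,D)$-$\ell_2$-RIP for some $k\ge 1$ and $D\ge 1$. Fix $\eta > 0$ such that $$\frac{C_1 D^8}{(1-\alpha)^4}\le n^\eta \le \frac{C_2k^3}{D^4n^2}.$$ Then there is a submatrix $T\in \mathbb{R}^{t\times n}$ consisting of some rows of $A$, for some $t \le m$, with the following properties: (1) $\frac{\|T\|_F^2}{\|A\|_F^2} \ge n^{-\eta}$; (2) $t \ge \Omega\left( \frac{k^3}{D^4n^{2+\eta}}\right)$; (3) every row $x$ of $T$ satisfies $$\Delta_{1,2}(x) \le O\left(\left(\frac{D^3 n}{\eta \sqrt{1-\alpha}\log n}\right)^{1/2}\right).$$ In particular, every row of $T$ is $\sqrt{s/n}$-far from all $s$-sparse vectors, where $s = \Omega\left(\frac{\eta \sqrt{1-\alpha}\log n}{D^3}\right)$.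
   Context: For $p\ge1$, a matrix $A \in \mathbb{R}^{m \times n}$ is $(k, D)$-$\ell_p$-RIP if there exists $K > 0$ such that for every $k$-sparse $x \in \mathbb{R}^n$ (at most $k$ nonzero entries), $K\|x\|_p \leq \|Ax\|_p \leq D K\|x\|_p$. For nonzero $x\in\mathbb{R}^n$, the $(\ell_1,\ell_2)$-distortion is $\Delta_{1,2}(x) = \frac{\|x\|_2 \sqrt{n}}{\|x\|_1}$. $\|A\|_F$ is the Frobenius norm. Implicit constants in $O(\cdot),\Omega(\cdot)$ are absolute constants. ''A vector $x$ is $\varepsilon$-far from all $s$-sparse vectors'' means $\|x-y\|_2 > \varepsilon\|x\|_2$ for every $s$-sparse $y$. *)

(* Defs.v *)
From HB Require Import structures.
From mathcomp Require Export all_boot all_order all_algebra.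
From mathcomp Require Export reals exp.

Set Implicit Arguments.
Unset Strict Implicit.
Unset Printing Implicit Defensive.

Import Order.TTheory GRing.Theory Num.Theory.
Local Open Scope ring_scope.

Definition lpnorm (R : realType) (p : R) (n : nat) (x : 'cV[R]_n) : R :=
  (\sum_(i < n) `|x i ord0| `^ p) `^ p^-1.

Definition frobenius_norm (R : realType) (m n : nat) (A : 'M[R]_(m, n)) : R :=
  Num.sqrt (\sum_(i < m) \sum_(j < n) A i j ^+ 2).

(* The sparsity level is a real number, since it may come from an asymptotic
   expression that need not be an integer. *)
Definition sparse (R : realType) (n : nat) (s : R) (x : 'cV[R]_n) : Prop :=
  (#|[set i : 'I_n | x i ord0 != 0]|)%:R <= s.

Definition lpRIP (R : realType) (p : R) (m n k : nat) (D : R)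
    (A : 'M[R]_(m, n)) : Prop :=
  exists2 K : R, 0 < K &
    forall x : 'cV[R]_n, sparse k%:R x ->
      K * lpnorm p x <= lpnorm p (A *m x) <= D * K * lpnorm p x.

(* Meaningful only for x != 0; the value at 0 is the junk value 0. *)
Definition distortion12 (R : realType) (n : nat) (x : 'cV[R]_n) : R :=
  lpnorm 2 x * Num.sqrt n%:R / lpnorm 1 x.

Definition far_from_sparse (R : realType) (n : nat) (e s : R)
    (x : 'cV[R]_n) : Prop :=
  forall y : 'cV[R]_n, sparse s y -> e * lpnorm 2 x < lpnorm 2 (x - y).

(* Main.v *)
Require Import Defs.
From mathcomp Require Import all_boot all_order all_algebra.
From mathcomp Require Import reals sequences exp.
From mathcomp Require Import ring lra.
Import Order.TTheory GRing.Theory Num.Theory.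
Local Open Scope ring_scope.

Set Implicit Arguments.
Unset Strict Implicit.
Unset Printing Implicit Defensive.

(** Normalise the RIP constant [K] to 1, put [delta := 1 - alpha], and let [B]
    consist of the rows with [l1 ^ 2 <= L * l2 ^ 2], where
    [L ~ eta * sqrt delta * ln n / D ^ 3]. If the other rows carried less than
    an [n ^ (- eta)] fraction of the Frobenius mass, the Gram matrix
    [M = B^T B] would have total l1 mass at most [c n] with [c = L D ^ 2].
    Weighting coordinate [i] by [1 / d i], where [d i = 1 + (l1 mass of row i of
    M) / c], gives a Gram matrix [W M W] of norm at most [c], whose kernel has
    dimension at least [delta n]. A normalised Dirichlet kernel [P] of degree
    [l ~ eta * ln n] in [W M W] fixes the kernel, contracts, and satisfies
    [(W M W) P ^ 2 <= c / (2 l + 1) ^ 2]. On average over [i], with weights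
    [d i], the vector [W P e_i] has squared norm at least [delta / 2] (because
    [d i / d j + d j / d i >= 2]), its image under [A] is much shorter, and its
    l1 norm is at most [3 * 7 ^ l * sqrt (8 / delta)], a small power of [n].
    Such a vector is close to a k-sparse one, which contradicts the RIP. *)

(** * Frobenius inner product and squared norm *)

Definition sqn {R : realType} {m n : nat} (A : 'M[R]_(m, n)) : R :=
  \sum_i \sum_j A i j ^+ 2.

Definition inner {R : realType} {m n : nat} (A B : 'M[R]_(m, n)) : R :=
  \tr (A^T *m B).

Definition l1 {R : realType} {n : nat} (x : 'cV[R]_n) : R :=
  \sum_i `|x i ord0|.

Section Frobenius.
Variables (R : realType).
Implicit Types (m n q : nat).

Lemma sqn_ge0 m n (A : 'M[R]_(m, n)) : 0 <= sqn A.
Proof. by do 2![apply: sumr_ge0 => ? _]; exact: sqr_ge0. Qed.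

Lemma sqn_tr m n (A : 'M[R]_(m, n)) : sqn A^T = sqn A.
Proof.
rewrite /sqn exchange_big; apply: eq_bigr => i _.
by apply: eq_bigr => j _; rewrite mxE.
Qed.

Lemma inner_sum m n (A B : 'M[R]_(m, n)) :
  inner A B = \sum_i \sum_j A i j * B i j.
Proof.
rewrite /inner /mxtrace exchange_big; apply: eq_bigr => j _.
by rewrite mxE; apply: eq_bigr => i _; rewrite mxE.
Qed.

Lemma inner_sqn m n (A : 'M[R]_(m, n)) : inner A A = sqn A.
Proof. by rewrite inner_sum. Qed.

Lemma innerC m n (A B : 'M[R]_(m, n)) : inner A B = inner B A.
Proof. by rewrite /inner -mxtrace_tr trmx_mul trmxK. Qed.

Lemma innerDr m n (A B C : 'M[R]_(m, n)) :
  inner A (B + C) = inner A B + inner A C.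
Proof. by rewrite /inner mulmxDr mxtraceD. Qed.

Lemma innerZr m n (a : R) (A B : 'M[R]_(m, n)) :
  inner A (a *: B) = a * inner A B.
Proof. by rewrite /inner -scalemxAr mxtraceZ. Qed.

Lemma innerBr m n (A B C : 'M[R]_(m, n)) :
  inner A (B - C) = inner A B - inner A C.
Proof. by rewrite innerDr -scaleN1r innerZr mulN1r. Qed.

Lemma inner_mull m n q (E : 'M[R]_(q, m)) (A : 'M[R]_(m, n)) (B : 'M_(q, n)) :
  inner (E *m A) B = inner A (E^T *m B).
Proof. by rewrite /inner trmx_mul mulmxA. Qed.

Lemma sqnD m n (A B : 'M[R]_(m, n)) :
  sqn (A + B) = sqn A + 2 * inner A B + sqn B.
Proof.
rewrite -!inner_sqn innerDr ![inner (A + B) _]innerC !innerDr (innerC B A).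
by ring.
Qed.

Lemma sqnZ m n (a : R) (A : 'M[R]_(m, n)) : sqn (a *: A) = a ^+ 2 * sqn A.
Proof. by rewrite -!inner_sqn innerZr innerC innerZr; ring. Qed.

Lemma sqnB m n (A B : 'M[R]_(m, n)) :
  sqn (A - B) = sqn A - 2 * inner A B + sqn B.
Proof. by rewrite sqnD -scaleN1r innerZr sqnZ; ring. Qed.

(** Cauchy-Schwarz in quotient form: the gap between the two sides is
    [sqn (t *: A - s *: B) / (s * t)]. *)
Lemma sqnD_titu m n (s t : R) (A B : 'M[R]_(m, n)) : 0 < s -> 0 < t ->
  sqn (A + B) <= (s + t) * (sqn A / s + sqn B / t).
Proof.
move=> s0 t0; have := sqn_ge0 (t *: A - s *: B).
rewrite sqnB !sqnZ innerZr innerC innerZr innerC => h.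
rewrite -subr_ge0 sqnD.
have -> : (s + t) * (sqn A / s + sqn B / t) - (sqn A + 2 * inner A B + sqn B) =
  (t ^+ 2 * sqn A - 2 * (s * (t * inner A B)) + s ^+ 2 * sqn B) / (s * t).
  by field; rewrite !gt_eqF.
by rewrite divr_ge0 // mulr_ge0 ?ltW.
Qed.

Lemma sqnB_le m n (A B : 'M[R]_(m, n)) : sqn (A - B) <= 2 * (sqn A + sqn B).
Proof. by have := sqn_ge0 (A + B); rewrite sqnB sqnD; lra. Qed.

Lemma sqn_eq0 m n (A : 'M[R]_(m, n)) : (sqn A == 0) = (A == 0).
Proof.
apply/eqP/eqP => [h|->]; last first.
  by rewrite /sqn big1 // => i _; rewrite big1 // => j _; rewrite mxE expr0n.
apply/matrixP => i j; rewrite mxE; apply/eqP; rewrite -sqrf_eq0; apply/eqP.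
have /psumr_eq0P h1 : forall i, true -> 0 <= \sum_j A i j ^+ 2.
  by move=> ? _; apply: sumr_ge0 => ? _; exact: sqr_ge0.
have /psumr_eq0P h2 : forall j, true -> 0 <= A i j ^+ 2.
  by move=> ? _; exact: sqr_ge0.
by apply: h2 => //; apply: h1.
Qed.

Lemma sqn_cV n (x : 'cV[R]_n) : sqn x = \sum_i x i ord0 ^+ 2.
Proof. by apply: eq_bigr => i _; rewrite big_ord1. Qed.

Lemma sqn_cols m n (A : 'M[R]_(m, n)) : sqn A = \sum_j sqn (col j A).
Proof.
rewrite /sqn exchange_big; apply: eq_bigr => j _.
by apply: eq_bigr => i _; rewrite big_ord1 mxE.
Qed.

Lemma sqn_rows m n (A : 'M[R]_(m, n)) : sqn A = \sum_i sqn (row i A).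
Proof.
by apply: eq_bigr => i _; rewrite /sqn big_ord1; apply: eq_bigr => j _; rewrite mxE.
Qed.

(** Cauchy-Schwarz: the double sum of [(F i - F j) ^+ 2] is twice the gap. *)
Lemma sum_sqr_le (I : finType) (P : pred I) (F : I -> R) :
  (\sum_(i | P i) F i) ^+ 2 <= #|P|%:R * \sum_(i | P i) F i ^+ 2.
Proof.
have : 0 <= \sum_(i | P i) \sum_(j | P j) (F i - F j) ^+ 2.
  by do 2![apply: sumr_ge0 => ? _]; exact: sqr_ge0.
have -> : \sum_(i | P i) \sum_(j | P j) (F i - F j) ^+ 2 =
  2 * (#|P|%:R * \sum_(i | P i) F i ^+ 2 - (\sum_(i | P i) F i) ^+ 2).
  have eF i : \sum_(j | P j) (F i - F j) ^+ 2 = F i ^+ 2 * #|P|%:R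
      - 2 * (F i * \sum_(j | P j) F j) + \sum_(j | P j) F j ^+ 2.
    rewrite mulr_sumr mulr_sumr.
    have -> : F i ^+ 2 * #|P|%:R = \sum_(j | P j) F i ^+ 2.
      by rewrite sumr_const mulr_natr.
    rewrite -sumrB -big_split /=.
    by apply: eq_bigr => j _; ring.
  under eq_bigr do rewrite eF.
  rewrite big_split sumrB /= -mulr_suml -mulr_sumr -mulr_suml sumr_const.
  by rewrite -[_ *+ _]mulr_natr; ring.
lra.
Qed.

(* Expand [0 <= sqn (P - Q)] for the orthogonal projection [Q] onto the row
   space of [K]. *)
Lemma sqn_ge_fixed_rank n q (K : 'M[R]_(q, n)) (P : 'M[R]_n) :
  P^T = P -> P *m K^T = K^T -> (\rank K)%:R <= sqn P.
Proof.
move=> Ps PK.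
have [B [/submxP [C BE] Bfree]] :
    exists B : 'M_(\rank K, n), (B <= K)%MS /\ row_free B.
  by exists (row_base K); rewrite eq_row_base row_base_free.
have PB : P *m B^T = B^T by rewrite BE trmx_mul mulmxA PK.
clear C BE.
have BBu : B *m B^T \in unitmx.
  rewrite -row_free_unit; apply: inj_row_free => v hv.
  have : sqn (v *m B) == 0.
    rewrite -sqn_tr -inner_sqn /inner trmxK trmx_mul mulmxA.
    by rewrite -[v *m B *m _]mulmxA hv mul0mx mxtrace0.
  rewrite sqn_eq0 => /eqP hvB; apply/eqP.
  by rewrite -(mulmx_free_eq0 v Bfree) hvB.
pose Q := B^T *m invmx (B *m B^T) *m B.
have Qs : Q^T = Q.
  by rewrite /Q !trmx_mul trmxK trmx_inv trmx_mul trmxK mulmxA.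
have trQ : \tr Q = (\rank K)%:R.
  by rewrite /Q mxtrace_mulC mulmxA mulmxV // mxtrace1.
have QQ : Q *m Q = Q.
  rewrite /Q !mulmxA -[_ *m B *m B^T]mulmxA -[_ *m invmx _ *m (B *m _)]mulmxA.
  by rewrite mulVmx // mulmx1.
have PQ : P *m Q = Q by rewrite /Q !mulmxA PB.
have := sqn_ge0 (P - Q); rewrite sqnB -(inner_sqn Q) /inner Ps Qs PQ QQ trQ.
lra.
Qed.

End Frobenius.

(** * Chebyshev and Dirichlet polynomials of a symmetric contraction *)

(* At [cos t], [chebT k] is [cos (k t)] and [chebU k] is [sin (k t) / sin t]. *)
Fixpoint cheb {R : realType} (k : nat) : {poly R} * {poly R} :=
  if k is k'.+1 then
    let: (t, u) := cheb k' in ('X * t - (1 - 'X ^+ 2) * u, t + 'X * u)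
  else (1, 0).

Definition chebT {R : realType} k : {poly R} := (cheb k).1.
Definition chebU {R : realType} k : {poly R} := (cheb k).2.

(* At [cos t] this is [sin ((2 l + 1) t / 2) / sin (t / 2)]. *)
Definition dirichlet {R : realType} l : {poly R} :=
  chebT l + (1 + 'X) * chebU l.

Section Chebyshev.
Variable R : realType.
Implicit Types (p r : {poly R}) (n q k l : nat).

Lemma chebTS k :
  chebT k.+1 = 'X * chebT k - (1 - 'X ^+ 2) * chebU k :> {poly R}.
Proof. by rewrite /chebT /chebU /=; case: (cheb k). Qed.

Lemma chebUS k : chebU k.+1 = chebT k + 'X * chebU k :> {poly R}.
Proof. by rewrite /chebT /chebU /=; case: (cheb k). Qed.

Lemma cheb_pell k :
  chebT k ^+ 2 + (1 - 'X ^+ 2) * chebU k ^+ 2 = 1 :> {poly R}.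
Proof.
elim: k => [|k IH]; first by rewrite /chebT /chebU /=; ring.
by rewrite chebTS chebUS -{}[RHS]IH; ring.
Qed.

Lemma dirichletS l :
  dirichlet l.+1 = dirichlet l + 2 * chebT l.+1 :> {poly R}.
Proof. by rewrite /dirichlet chebUS chebTS; ring. Qed.

(** At [cos t] the two summands are [2 sin^2] and [2 cos^2] of [(2 l + 1) t / 2]. The factor
    [1 - 'X] is thus what tames the square of the kernel. *)
Lemma dirichlet_energy l :
  (1 - 'X) * dirichlet l ^+ 2
    + (1 + 'X) * (chebT l - (1 - 'X) * chebU l) ^+ 2 = 2 :> {poly R}.
Proof.
transitivity (2 * (chebT l ^+ 2 + (1 - 'X ^+ 2) * chebU l ^+ 2) : {poly R}).
  by rewrite /dirichlet; ring.
by rewrite cheb_pell mulr1.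
Qed.

Lemma dirichlet_at1 l : (dirichlet l : {poly R}).[1] = l.*2.+1%:R.
Proof.
have T1 k : (chebT k : {poly R}).[1] = 1.
  elim: k => [|k IH]; first by rewrite /chebT /= hornerC.
  by rewrite chebTS !hornerE IH; ring.
elim: l => [|l IH].
  by rewrite /dirichlet /chebT /chebU /= mulr0 addr0 hornerC.
by rewrite dirichletS hornerD IH hornerM T1 hornerMn hornerC doubleS -!natr1; ring.
Qed.

Lemma horner_mx_sym n (X : 'M[R]_n.+1) p :
  X^T = X -> (horner_mx X p)^T = horner_mx X p.
Proof.
move=> Xs; elim/poly_ind: p => [|p c IH]; first by rewrite rmorph0 trmx0.
rewrite rmorphD rmorphM /= horner_mx_X horner_mx_C linearD /= tr_scalar_mx.
rewrite [in LHS]trmx_mul IH Xs; congr (_ + _).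
by have := comm_horner_mx2 X 'X p; rewrite horner_mx_X.
Qed.

Lemma horner_mx_fixed n q (X : 'M[R]_n.+1) (V : 'M_(n.+1, q)) p :
  X *m V = V -> horner_mx X p *m V = p.[1] *: V.
Proof.
move=> XV; elim/poly_ind: p => [|p c IH].
  by rewrite rmorph0 mul0mx horner0 scale0r.
rewrite rmorphD rmorphM /= horner_mx_X horner_mx_C mulmxDl mul_scalar_mx.
by rewrite -mulmxA XV IH !hornerE scalerDl.
Qed.

(** Lets a polynomial in the symmetric matrix, controlled in l2, be rewritten in a conjugate matrix
    that is controlled in l1. *)
Lemma horner_mx_intertwine n (W N X : 'M[R]_n.+1) p :
  W *m N = X *m W -> W *m horner_mx N p = horner_mx X p *m W.
Proof.
move=> WN; elim/poly_ind: p => [|p c IH]; first by rewrite !rmorph0 mul0mx mulmx0.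
rewrite !rmorphD !rmorphM /= !horner_mx_X !horner_mx_C mulmxDl mulmxDr.
rewrite scalar_mxC; congr (_ + _).
by rewrite [in LHS]mulmxA IH -!mulmxA WN.
Qed.

Lemma inner_horner n q (X : 'M[R]_n.+1) (V : 'M_(n.+1, q)) p r : X^T = X ->
  inner (horner_mx X p *m V) (horner_mx X r *m (horner_mx X p *m V)) =
  inner V (horner_mx X (r * p ^+ 2) *m V).
Proof.
move=> Xs; rewrite inner_mull horner_mx_sym // !mulmxA; congr (inner _ (_ *m _)).
have -> : r * p ^+ 2 = p * r * p by ring.
by rewrite !rmorphM.
Qed.

Section Contraction.
Variables (n : nat) (X : 'M[R]_n.+1).
Hypotheses (Xs : X^T = X).
Hypothesis (Xc : forall q (V : 'M[R]_(n.+1, q)), sqn (X *m V) <= sqn V).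

(** This replaces the spectral bound of [T_k] by 1 on [[-1, 1]]. By the Pell identity the loss
    [sqn V - sqn (T_k V)] is [sqn U - sqn (X U)] with [U = U_k V], and [X] contracts. *)
Lemma chebT_contraction k q (V : 'M[R]_(n.+1, q)) :
  sqn (horner_mx X (chebT k) *m V) <= sqn V.
Proof.
have := inner_horner V (chebT k) 1 Xs.
rewrite rmorph1 mul1mx mul1r inner_sqn => ->.
have -> : chebT k ^+ 2 = 1 - (1 - 'X ^+ 2) * chebU k ^+ 2 :> {poly R}.
  by apply/eqP; rewrite eq_sym subr_eq eq_sym cheb_pell.
rewrite rmorphB /= mulmxBl innerBr -inner_horner // rmorph1 mul1mx inner_sqn.
set U := _ *m V; rewrite rmorphB rmorph1 rmorphXn /= horner_mx_X.
rewrite mulmxBl mul1mx innerBr inner_sqn expr2 -mulmxA.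
have -> : inner U (X *m (X *m U)) = sqn (X *m U) by rewrite -inner_sqn inner_mull Xs.
by have := Xc U; lra.
Qed.

(** The kernel is [1 + 2 (T_1 + ... + T_l)]. The induction adds [2 T_(l+1)] by [sqnD_titu] with
    weights [2 l + 1] and [2], so that the norm bounds add up exactly. *)
Lemma dirichlet_bound l q (V : 'M[R]_(n.+1, q)) :
  sqn (horner_mx X (dirichlet l) *m V) <= l.*2.+1%:R ^+ 2 * sqn V.
Proof.
elim: l => [|l IH].
  have -> : dirichlet 0 = 1 :> {poly R} by rewrite /dirichlet /chebT /chebU /=; ring.
  by rewrite rmorph1 mul1mx expr1n mul1r.
rewrite dirichletS rmorphD rmorphM /= rmorph_nat mulmxDl.
have a0 : 0 < l.*2.+1%:R :> R by rewrite ltr0n.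
apply: (le_trans (sqnD_titu _ _ a0 (@ltr0n R 2))).
have -> : 2 * horner_mx X (chebT l.+1) *m V = 2 *: (horner_mx X (chebT l.+1) *m V).
  by rewrite mulr_natl !mulr2n mulmxDl scalerDl scale1r.
rewrite sqnZ.
have := chebT_contraction l.+1 V.
have e2 : l.+1.*2.+1%:R = l.*2.+1%:R + 2 :> R by rewrite doubleS -!natr1; ring.
rewrite e2; move: IH a0; set a := _%:R => IH a0 h.
have h1 : sqn (horner_mx X (dirichlet l) *m V) / a <= a * sqn V.
  by rewrite ler_pdivrMr // mulrAC -expr2.
rewrite -[(a + 2) ^+ 2 * _]mulrA ler_wpM2l //; first lra.
clearbody a; lra.
Qed.

(** By the energy identity the left side is [2 * sqn V] minus [inner Z (Z + X *m Z)]. The latter is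
    nonnegative since [sqn (Z + X *m Z)] is at most twice it. *)
Lemma dirichlet_dissipation l q (U V : 'M[R]_(n.+1, q)) :
  U = horner_mx X (dirichlet l) *m V ->
  inner U ((1%:M - X) *m U) <= 2 * sqn V.
Proof.
move=> ->.
have eX : 1%:M - X = horner_mx X (1 - 'X).
  by rewrite rmorphB !rmorph1 /= horner_mx_X.
rewrite eX inner_horner //.
have -> : (1 - 'X) * dirichlet l ^+ 2 =
    2 - (1 + 'X) * (chebT l - (1 - 'X) * chebU l) ^+ 2 :> {poly R}.
  by apply/eqP; rewrite eq_sym subr_eq eq_sym dirichlet_energy.
rewrite rmorphB /= mulmxBl innerBr -inner_horner //.
set Z := horner_mx X (chebT l - _) *m V.
have -> : inner V (horner_mx X 2 *m V) = 2 * sqn V.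
  by rewrite rmorph_nat -inner_sqn -innerZr scaler_nat !mulr2n mulmxDl mul1mx.
rewrite rmorphD rmorph1 /= horner_mx_X mulmxDl mul1mx innerDr inner_sqn.
have := sqn_ge0 (Z + X *m Z); rewrite sqnD; have := Xc Z; lra.
Qed.

End Contraction.

End Chebyshev.

(** * Growth of the Dirichlet kernel in the l1 norm *)

Section L1Norm.
Variable R : realType.

Lemma l1_ge0 n (u : 'cV[R]_n) : 0 <= l1 u.
Proof. exact: sumr_ge0. Qed.

Lemma l1D n (u v : 'cV[R]_n) : l1 (u + v) <= l1 u + l1 v.
Proof. by rewrite -big_split; apply: ler_sum => i _; rewrite mxE ler_normD. Qed.

Lemma l1N n (u : 'cV[R]_n) : l1 (- u) = l1 u.
Proof. by apply: eq_bigr => i _; rewrite mxE normrN. Qed.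

Lemma l1B n (u v : 'cV[R]_n) : l1 (u - v) <= l1 u + l1 v.
Proof. by rewrite -(l1N v) l1D. Qed.

Lemma l1Z n (a : R) (u : 'cV[R]_n) : l1 (a *: u) = `|a| * l1 u.
Proof. by rewrite mulr_sumr; apply: eq_bigr => i _; rewrite mxE normrM. Qed.

Lemma l1_delta n (i : 'I_n) : l1 (delta_mx i ord0 : 'cV[R]_n) = 1.
Proof.
rewrite /l1 (bigD1 i) //= mxE !eqxx normr1 big1 ?addr0 // => j /negPf ji.
by rewrite mxE ji normr0.
Qed.

Lemma l1_mulmx m n (N : 'M[R]_(m, n)) (c : R) (u : 'cV_n) :
  (forall j, \sum_i `|N i j| <= c) -> l1 (N *m u) <= c * l1 u.
Proof.
move=> Nc; apply: (@le_trans _ _ (\sum_i \sum_j `|N i j| * `|u j ord0|)).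
  apply: ler_sum => i _; rewrite mxE; apply: (le_trans (ler_norm_sum _ _ _)).
  by apply: ler_sum => j _; rewrite normrM.
rewrite exchange_big mulr_sumr; apply: ler_sum => j _ /=.
by rewrite -mulr_suml ler_wpM2r.
Qed.

Lemma l1_dirichlet n (Y : 'M[R]_n.+1) l (u : 'cV_n.+1) :
  (forall v, l1 (Y *m v) <= 3 * l1 v) ->
  l1 (horner_mx Y (dirichlet l) *m u) <= 3 * 7 ^+ l * l1 u.
Proof.
move=> Y3.
have YX2 v : l1 (horner_mx Y (1 - 'X ^+ 2) *m v) <= 10 * l1 v.
  rewrite rmorphB rmorph1 rmorphXn /= horner_mx_X mulmxBl mul1mx expr2 -mulmxA.
  apply: (le_trans (l1B _ _)); have := Y3 v; have := Y3 (Y *m v); lra.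
have Y1X v : l1 (horner_mx Y (1 + 'X) *m v) <= 4 * l1 v.
  rewrite rmorphD rmorph1 /= horner_mx_X mulmxDl mul1mx.
  apply: (le_trans (l1D _ _)); have := Y3 v; lra.
(* Joint invariant giving the rate 7: the recurrences need [3 + 10 / 3 <= 7] for [chebT] and
   [3 * (1 + 1) <= 7] for [chebU]. At the end [1 + 4 / 3 <= 3]. *)
have TU k : l1 (horner_mx Y (chebT k) *m u) <= 7 ^+ k * l1 u /\
            3 * l1 (horner_mx Y (chebU k) *m u) <= 7 ^+ k * l1 u.
  have c0 j : 0 <= 7 ^+ j * l1 u by rewrite mulr_ge0 ?l1_ge0 ?exprn_ge0.
  elim: k => [|k [IHT IHU]].
    rewrite /chebT /chebU /= rmorph1 rmorph0 mul1mx mul0mx expr0 mul1r.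
    by rewrite /l1 [X in 3 * X]big1 ?mulr0 ?l1_ge0 // => i _; rewrite mxE normr0.
  split.
    rewrite chebTS rmorphB 2!rmorphM /= mulmxBl -!mulmxA [horner_mx Y 'X]horner_mx_X.
    apply: (le_trans (l1B _ _)).
    set t := horner_mx Y (chebT k) *m u; set s := horner_mx Y (chebU k) *m u.
    have := Y3 t; have := YX2 s; rewrite (exprS 7) -/t -/s in IHT IHU *; have := c0 k; lra.
  rewrite chebUS rmorphD rmorphM /= mulmxDl -!mulmxA [horner_mx Y 'X]horner_mx_X.
  set t := horner_mx Y (chebT k) *m u; set s := horner_mx Y (chebU k) *m u.
  have := l1D t (Y *m s).
  by have := Y3 s; rewrite (exprS 7) -/t -/s in IHT IHU *; have := c0 k; lra.
have [hT hU] := TU l.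
rewrite /dirichlet rmorphD rmorphM /= mulmxDl -mulmxA.
apply: (le_trans (l1D _ _)).
have := Y1X (horner_mx Y (chebU l) *m u); have := l1_ge0 (horner_mx Y (chebU l) *m u).
by lra.
Qed.

End L1Norm.

(** * Operator bounds for weighted Gram matrices *)

Section Gram.
Variable R : realType.

(** The spectrum of [E^T E] lies in [[0, c]], so the reflected matrix has spectrum in [[-1, 1]].
    Spectral theory is avoided: the nonnegative square [sqn (E V - c^-1 E U)], with [U = E^T E V],
    gives [sqn U <= c * sqn (E V)]. *)
Lemma sqn_gram_contraction m n (E : 'M[R]_(m, n)) (c : R) : 0 < c ->
  (forall q (V : 'M_(n, q)), sqn (E *m V) <= c * sqn V) ->
  forall q (V : 'M_(n, q)),
    sqn ((1%:M - (2 / c) *: (E^T *m E)) *m V) <= sqn V.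
Proof.
move=> c0 Ec q V; rewrite mulmxBl mul1mx -scalemxAl -mulmxA.
set U := E^T *m (E *m V).
have VU : inner V U = sqn (E *m V) by rewrite -inner_sqn inner_mull.
have EU : inner (E *m V) (E *m U) = sqn U by rewrite innerC inner_mull inner_sqn.
have := sqn_ge0 (E *m V - c^-1 *: (E *m U)).
rewrite sqnB innerZr EU sqnZ => h.
have h1 : c^-1 ^+ 2 * sqn (E *m U) <= c^-1 * sqn U.
  by rewrite expr2 -mulrA ler_wpM2l ?invr_ge0 ?(ltW c0) // ler_pdivrMl // Ec.
rewrite sqnB innerZr VU sqnZ -subr_ge0.
have -> : sqn V - (sqn V - 2 * (2 / c * sqn (E *m V)) + (2 / c) ^+ 2 * sqn U) =
  4 / c * (sqn (E *m V) - c^-1 * sqn U) by ring.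
rewrite mulr_ge0 ?divr_ge0 ?(ltW c0) //; lra.
Qed.

(** Weighted Schur test. With [y i = v i / sqrt (d i)], each [M i j * y i * y j] is split by the
    arithmetic-geometric mean inequality. The row sums then contribute
    [c * d i * y i ^ 2 = c * v i ^ 2]. *)
Lemma sqn_schur m n (B : 'M[R]_(m, n)) (c : R) (d : 'I_n -> R) :
  (forall i, 0 < d i) ->
  (forall i, \sum_j `|(B^T *m B) i j| <= c * d i) ->
  forall q (V : 'M_(n, q)),
    sqn (B *m diag_mx (\row_i (Num.sqrt (d i))^-1) *m V) <= c * sqn V.
Proof.
move=> d0 Bc q V; rewrite !sqn_cols mulr_sumr; apply: ler_sum => a _.
rewrite !colE -!mulmxA; set v := V *m _; set y := _ *m v.
have yE i : y i ord0 = (Num.sqrt (d i))^-1 * v i ord0.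
  by rewrite /y mul_diag_mx !mxE.
have yd i : d i * y i ord0 ^+ 2 = v i ord0 ^+ 2.
  by rewrite yE exprMn exprVn sqr_sqrtr ?ltW // mulVKf ?gt_eqF.
set M := B^T *m B in Bc *.
have Ms i j : `|M i j| = `|M j i|.
  by rewrite /M -[in RHS](trmxK B) -trmx_mul [in RHS]mxE trmxK.
have -> : sqn (B *m y) = \sum_i \sum_j y i ord0 * M i j * y j ord0.
  rewrite -inner_sqn inner_mull mulmxA -/M inner_sum; apply: eq_bigr => i _.
  by rewrite big_ord1 [(M *m y) _ _]mxE mulr_sumr; apply: eq_bigr => j _; rewrite mulrA.
apply: (@le_trans _ _ (\sum_i \sum_j (`|M i j| * y i ord0 ^+ 2 / 2
                                    + `|M i j| * y j ord0 ^+ 2 / 2))).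
  apply: ler_sum => i _; apply: ler_sum => j _.
  apply: (le_trans (ler_norm _)); rewrite !normrM.
  rewrite -(real_normK (num_real (y i ord0))) -(real_normK (num_real (y j ord0))).
  have := mulr_ge0 (normr_ge0 (M i j)) (sqr_ge0 (`|y i ord0| - `|y j ord0|)).
  lra.
under eq_bigr do rewrite big_split /=.
rewrite big_split /= [X in _ + X]exchange_big /= -big_split sqn_cV mulr_sumr.
apply: ler_sum => i _ /=; under [X in _ + X]eq_bigr do rewrite Ms.
rewrite -!mulr_suml -yd.
have := ler_wpM2r (sqr_ge0 (y i ord0)) (Bc i); lra.
Qed.

End Gram.

(** * Consequences of the restricted isometry property with [K = 1] *)

Definition supp {R : realType} {n : nat} (x : 'cV[R]_n) : {set 'I_n} :=
  [set i | x i ord0 != 0].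

Section RIP.
Variables (R : realType) (m n k : nat) (D : R) (A : 'M[R]_(m, n)).
Hypotheses (k0 : (0 < k)%N) (kn : (k <= n)%N).
Hypothesis Aup : forall x, (#|supp x| <= k)%N -> sqn (A *m x) <= D ^+ 2 * sqn x.

(** Cut the coordinates into [n %/ k + 1 <= 2 n / k] blocks of at most [k] consecutive indices,
    apply the upper bound to each block, and use Cauchy-Schwarz over the blocks. *)
Lemma rip_opnorm (x : 'cV_n) :
  sqn (A *m x) <= D ^+ 2 * (2 * n%:R / k%:R) * sqn x.
Proof.
pose N := (n %/ k).+1.
pose xb (b : 'I_N) : 'cV[R]_n := \col_i (if (i %/ k == b)%N then x i ord0 else 0).
have xE : x = \sum_b xb b.
  apply/matrixP => i j; rewrite ord1 summxE.
  have iN : (i %/ k < N)%N by rewrite ltnS leq_div2r // ltnW.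
  rewrite (bigD1 (Ordinal iN)) //= mxE /= eqxx big1 ?addr0 // => b bi.
  rewrite mxE; case: eqP => // ib; case/eqP: bi; exact: val_inj.
have xbs b : (#|supp (xb b)| <= k)%N.
  rewrite -[leqRHS]card_ord.
  pose f (i : 'I_n) : 'I_k := Ordinal (ltn_pmod i k0).
  apply: (leq_trans _ (max_card [in f @: supp (xb b)])).
  rewrite card_in_imset // => i j; rewrite !inE !mxE.
  case: ifP => [/eqP ib _|_ /eqP//]; case: ifP => [/eqP jb _|_ /eqP//].
  move=> /(congr1 val) /= fij; apply: val_inj => /=.
  by rewrite (divn_eq i k) (divn_eq j k) ib jb fij.
have sxb : \sum_b sqn (xb b) = sqn x.
  rewrite sqn_cV; under eq_bigr do rewrite sqn_cV.
  rewrite exchange_big; apply: eq_bigr => i _ /=.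
  have iN : (i %/ k < N)%N by rewrite ltnS leq_div2r // ltnW.
  rewrite (bigD1 (Ordinal iN)) //= mxE /= eqxx big1 ?addr0 // => b bi.
  rewrite mxE; case: eqP => [ib|_]; last by rewrite expr0n.
  by case/eqP: bi; exact: val_inj.
have step : sqn (A *m x) <= N%:R * \sum_b sqn (A *m xb b).
  rewrite {1}xE mulmx_sumr sqn_cV.
  apply: (@le_trans _ _ (\sum_i N%:R * \sum_b (A *m xb b) i ord0 ^+ 2)).
    apply: ler_sum => i _; rewrite summxE -[X in X%:R * _](card_ord N).
    exact: sum_sqr_le.
  rewrite -mulr_sumr exchange_big ler_wpM2l //=.
  by apply: ler_sum => b _; rewrite sqn_cV.
apply: (le_trans step).
have kp : 0 < k%:R :> R by rewrite ltr0n.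
have Nk : N%:R <= 2 * n%:R / k%:R :> R.
  rewrite ler_pdivlMr // -!natrM ler_nat /N mulSn mul2n -addnn leq_add //.
  exact: leq_trunc_div.
apply: (@le_trans _ _ (2 * n%:R / k%:R * (D ^+ 2 * sqn x))); last by lra.
apply: ler_pM => //; first by apply: sumr_ge0 => b _; exact: sqn_ge0.
by rewrite -sxb mulr_sumr; apply: ler_sum => b _; exact: Aup.
Qed.

Hypothesis Alow : forall x, (#|supp x| <= k)%N -> sqn x <= sqn (A *m x).
Hypothesis D1 : 1 <= D.

(* Hard thresholding of [v] at height [l1 v / k] splits it into a k-sparse
   vector and a remainder of squared norm at most [l1 v ^ 2 / k]. *)
Lemma rip_l1_lower (v : 'cV_n) :
  sqn v <= 2 * sqn (A *m v) + 5 * D ^+ 2 * n%:R / k%:R ^+ 2 * l1 v ^+ 2.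
Proof.
have kp : 0 < k%:R :> R by rewrite ltr0n.
have l0 : 0 <= l1 v by apply: sumr_ge0.
pose t := l1 v / k%:R.
have t0 : 0 <= t by rewrite divr_ge0 // ltW.
pose g : 'cV[R]_n := \col_i (if t < `|v i ord0| then v i ord0 else 0).
pose h : 'cV[R]_n := \col_i (if t < `|v i ord0| then 0 else v i ord0).
have hE : h = v - g.
  by apply/matrixP => i j; rewrite ord1 !mxE; case: ifP; rewrite ?subrr ?subr0.
have ghE : sqn v = sqn g + sqn h.
  rewrite !sqn_cV -big_split; apply: eq_bigr => i _; rewrite !mxE /=.
  by case: ifP; rewrite expr0n ?addr0 ?add0r.
(* Markov's inequality at height [t = l1 v / k]. The empty support is treated apart because division
   by [t] needs [t > 0]. *)
have gs : (#|supp g| <= k)%N.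
  have [->|/set0Pn[i0]] := eqVneq (supp g) set0; first by rewrite cards0.
  rewrite !inE mxE; case: ifP => [ti0 _|_ /eqP//].
  have vi0 : `|v i0 ord0| <= l1 v.
    by rewrite /l1 (bigD1 i0) //= lerDl sumr_ge0.
  have lp : 0 < l1 v by apply: lt_le_trans vi0; apply: le_lt_trans ti0.
  have tp : 0 < t by rewrite divr_gt0.
  rewrite -(ler_nat R) -(ler_pM2r tp) [leRHS]mulrC divfK ?gt_eqF //.
  rewrite mulr_natl -sumr_const.
  apply: (@le_trans _ _ (\sum_(i in supp g) `|v i ord0|)).
    apply: ler_sum => i; rewrite !inE mxE; case: ifP => [/ltW//|_ /eqP//].
  rewrite /l1 [leRHS](bigID (mem (supp g))) /= lerDl; exact: sumr_ge0.
have hs : sqn h <= l1 v ^+ 2 / k%:R.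
  have -> : l1 v ^+ 2 / k%:R = t * l1 v by rewrite /t; ring.
  rewrite sqn_cV /l1 mulr_sumr; apply: ler_sum => i _; rewrite !mxE -/(l1 v).
  case: ltP => [_|vt]; first by rewrite expr0n mulr_ge0.
  by rewrite -(real_normK (num_real _)) expr2 ler_wpM2r.
have := Alow gs; have -> : A *m g = A *m v - A *m h.
  by rewrite hE mulmxBr opprB addrC subrK.
move=> /le_trans /(_ (sqnB_le _ _)) h1.
have h2 := rip_opnorm h.
have n1 : 1 <= n%:R / k%:R :> R by rewrite ler_pdivlMr // mul1r ler_nat.
have D2 : 1 <= D ^+ 2 by rewrite expr_ge1 // (le_trans ler01).
have h3 : 1 <= D ^+ 2 * (n%:R / k%:R) by rewrite -[leLHS]mulr1 ler_pM.
have e : 5 * D ^+ 2 * n%:R / k%:R ^+ 2 * l1 v ^+ 2 =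
   5 * (D ^+ 2 * (n%:R / k%:R)) * (l1 v ^+ 2 / k%:R).
  by field; rewrite gt_eqF.
rewrite e ghE.
have e2 : D ^+ 2 * (2 * n%:R / k%:R) = 2 * (D ^+ 2 * (n%:R / k%:R)) by ring.
rewrite e2 in h2.
move: h3 h2; set c := D ^+ 2 * _ => h3 h2.
(* The part [g] contributes [2 sqn (A v) + 4 c sqn h] and [h] itself one more [sqn h]. Since
   [c >= 1], the factor [4 c + 1] is at most [5 c]. *)
have : (4 * c + 1) * sqn h <= 5 * c * (l1 v ^+ 2 / k%:R).
  apply: ler_pM => //; [lra|exact: sqn_ge0|lra].
lra.
Qed.

(* Each row is bounded by testing [A] on that row. *)
Lemma rip_row_bound i : sqn (row i A) <= D ^+ 2 * (2 * n%:R / k%:R).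
Proof.
set c := _ * (_ / _).
have [r0|rn0] := eqVneq (sqn (row i A)) 0.
  by rewrite r0 mulr_ge0 ?sqr_ge0 // divr_ge0 // mulr_ge0.
have rp : 0 < sqn (row i A) by rewrite lt_def rn0 sqn_ge0.
have := rip_opnorm (row i A)^T; rewrite -/c sqn_tr.
suff : sqn (row i A) ^+ 2 <= sqn (A *m (row i A)^T).
  by move=> /le_trans h /h; rewrite expr2 ler_pM2r.
rewrite [leRHS]sqn_cV (bigD1 i) //=.
have -> : (A *m (row i A)^T) i ord0 = sqn (row i A).
  by rewrite mxE /sqn big_ord1; apply: eq_bigr => j _; rewrite !mxE expr2.
by rewrite lerDl sumr_ge0 // => j _; exact: sqr_ge0.
Qed.

(** Each column is the image of a basis vector, which is k-sparse because [k] is positive. *)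
Lemma rip_sqn_le : sqn A <= D ^+ 2 * n%:R.
Proof.
rewrite sqn_cols mulrC mulr_natl -[X in _ *+ X](card_ord n) -sumr_const.
apply: ler_sum => j _; rewrite colE.
apply: (le_trans (Aup _)); last first.
  rewrite sqn_cV (bigD1 j) //= mxE !eqxx big1 ?addr0 ?expr1n ?mulr1 // => i ij.
  by rewrite mxE (negPf ij) expr0n.
apply: leq_trans k0; rewrite -[leqRHS](cards1 j); apply/subset_leq_card/subsetP => i.
by rewrite !inE mxE; case: (i == j) => //; rewrite eqxx.
Qed.

Lemma rip_sqn_ge : n%:R <= sqn A.
Proof.
rewrite sqn_cols -[X in X%:R <= _](card_ord n) -sumr_const.
apply: ler_sum => j _; rewrite colE.
apply: le_trans (Alow _).
  rewrite sqn_cV (bigD1 j) //= mxE !eqxx expr1n lerDl sumr_ge0 // => i _.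
  exact: sqr_ge0.
apply: leq_trans k0; rewrite -[leqRHS](cards1 j); apply/subset_leq_card/subsetP => i.
by rewrite !inE mxE; case: (i == j) => //; rewrite eqxx.
Qed.

End RIP.

(** * Weighted averaging of the Dirichlet test vectors *)

Section Averaging.
Variables (R : realType) (m n : nat) (B : 'M[R]_(m, n.+1)) (c : R) (l : nat).
Hypothesis c0 : 0 < c.

Let M := B^T *m B.
(** The summand 1 makes [W] a contraction. The other summand makes row [i] of [M] have l1 mass at
    most [c * d i], as [sqn_schur] requires. *)
Let d i : R := 1 + (\sum_j `|M i j|) / c.
Let W : 'M[R]_n.+1 := diag_mx (\row_i (Num.sqrt (d i))^-1).
Let E := B *m W.
Let X : 'M[R]_n.+1 := 1%:M - (2 / c) *: (E^T *m E).
Let o : R := l.*2.+1%:R.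
Let P : 'M[R]_n.+1 := o^-1 *: horner_mx X (dirichlet l).

Let o1 : 1 <= o. Proof. by rewrite ler1n. Qed.
Let o0 : 0 < o. Proof. exact: lt_le_trans o1. Qed.

Let Msym i j : M i j = M j i.
Proof. by rewrite /M -[in RHS](trmxK B) -trmx_mul [in RHS]mxE trmxK. Qed.

Let d1 i : 1 <= d i.
Proof. by rewrite lerDl divr_ge0 ?(ltW c0) // sumr_ge0. Qed.

Let d0 i : 0 < d i. Proof. exact: lt_le_trans (d1 i). Qed.

Let rowM i : \sum_j `|M i j| <= c * d i.
Proof. by rewrite mulrDr mulr1 [c * (_ / _)]mulrC divfK ?gt_eqF // lerDr ltW. Qed.

Let WE q (V : 'M[R]_(n.+1, q)) i j : (W *m V) i j = (Num.sqrt (d i))^-1 * V i j.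
Proof. by rewrite mul_diag_mx !mxE. Qed.

Let Wtr : W^T = W. Proof. exact: tr_diag_mx. Qed.

Let Ec q (V : 'M_(n.+1, q)) : sqn (E *m V) <= c * sqn V.
Proof. exact: sqn_schur. Qed.

Let Xsym : X^T = X.
Proof. by rewrite /X linearB linearZ /= tr_scalar_mx trmx_mul trmxK. Qed.

Let Xcontr q (V : 'M_(n.+1, q)) : sqn (X *m V) <= sqn V.
Proof. exact: sqn_gram_contraction. Qed.

Let Psym : P^T = P.
Proof. by rewrite /P linearZ /= horner_mx_sym. Qed.

Let Pcontr q (V : 'M_(n.+1, q)) : sqn (P *m V) <= sqn V.
Proof.
rewrite /P -scalemxAl sqnZ exprVn ler_pdivrMl ?exprn_gt0 //.
exact: dirichlet_bound.
Qed.

(** Here [1 - X] is [(2 / c) E^T E], so dissipation bounds [(2 / c) * sqn (E U)] by [2 * sqn V].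
    Normalising the kernel by [o] supplies the factor [o ^- 2]. *)
Let EPle q (V : 'M_(n.+1, q)) : sqn (E *m (P *m V)) <= c / o ^+ 2 * sqn V.
Proof.
rewrite /P -scalemxAl -scalemxAr sqnZ exprVn [c / _]mulrC -mulrA.
rewrite ler_wpM2l ?invr_ge0 ?exprn_ge0 ?(ltW o0) //.
set U := _ *m V.
have := dirichlet_dissipation Xsym Xcontr (erefl U).
rewrite /X opprB addrC subrK -scalemxAl innerZr -mulmxA -inner_mull inner_sqn.
rewrite -mulrA ler_pM2l // ler_pdivrMl //.
Qed.

(** On the kernel of [E] the matrix [X] is the identity, and the normalised Dirichlet polynomial is
    1 at 1. So [P] fixes this kernel, whose dimension is at least that of the ambient space minus
    the rank of [B]. *)
Let sqnP : (n.+1%:R - (\rank B)%:R) <= sqn P.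
Proof.
have := @sqn_ge_fixed_rank _ _ _ (kermx E^T) P Psym.
have EK : E *m (kermx E^T)^T = 0.
  by apply: trmx_inj; rewrite trmx_mul trmxK mulmx_ker trmx0.
have XK : X *m (kermx E^T)^T = (kermx E^T)^T.
  by rewrite /X mulmxBl mul1mx -scalemxAl -mulmxA EK mulmx0 scaler0 subr0.
rewrite {1}/P -scalemxAl (horner_mx_fixed _ XK) dirichlet_at1.
rewrite scalerA mulVf ?gt_eqF // scale1r mxrank_ker mxrank_tr => /(_ erefl).
apply: le_trans; rewrite natrB ?rank_leq_col // lerB // ler_nat.
exact: mxrankM_maxl.
Qed.

Let vec i : 'cV[R]_n.+1 := W *m (P *m delta_mx i ord0).

Let sqn_delta i : sqn (delta_mx i ord0 : 'cV[R]_n.+1) = 1.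
Proof.
rewrite sqn_cV (bigD1 i) //= mxE !eqxx expr1n big1 ?addr0 // => j /negPf ji.
by rewrite mxE ji expr0n.
Qed.

Let Pdelta i j : (P *m delta_mx i ord0 : 'cV_n.+1) j ord0 = P j i.
Proof. by rewrite -colE mxE. Qed.

Let sqn_vec i : sqn (vec i) = \sum_j P j i ^+ 2 / d j.
Proof.
rewrite sqn_cV; apply: eq_bigr => j _; rewrite WE Pdelta exprMn exprVn.
by rewrite sqr_sqrtr ?(ltW (d0 j)) // mulrC.
Qed.

Let colP i : \sum_j P j i ^+ 2 <= 1.
Proof.
have := Pcontr (delta_mx i ord0 : 'cV[R]_n.+1); rewrite sqn_delta sqn_cV.
by under eq_bigr do rewrite Pdelta.
Qed.

(* [X] and [1 - (2 / c) M W^2] are conjugate by [W], and the latter is bounded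
   on l1. *)
Let l1_vec i : l1 (vec i) ^+ 2 <= d i * (3 * 7 ^+ l) ^+ 2.
Proof.
pose Y : 'M[R]_n.+1 := 1%:M - (2 / c) *: (M *m (W *m W)).
have WY : W *m Y = X *m W.
  rewrite /Y /X /E mulmxBr mulmxBl mulmx1 mul1mx -scalemxAr -scalemxAl.
  by rewrite trmx_mul Wtr !mulmxA.
(* By symmetry of [M], column [j] of [M W^2] has l1 mass equal to that of row [j] of [M] over [d j],
   which is at most [c]. Hence the bound [1 + 2]. *)
have Y3 v : l1 (Y *m v) <= 3 * l1 v.
  rewrite /Y mulmxBl mul1mx -scalemxAl; apply: (le_trans (l1B _ _)).
  rewrite l1Z ger0_norm ?divr_ge0 ?(ltW c0) //.
  suff : l1 (M *m (W *m W) *m v) <= c * l1 v.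
    rewrite -[_ <= c * _](@ler_pM2l _ (2 / c)) ?divr_gt0 //.
    by rewrite mulrA divfK ?gt_eqF //; lra.
  apply: l1_mulmx => j.
  have MW a : (M *m (W *m W)) a j = M a j / d j.
    rewrite mulmxA !mul_mx_diag !mxE -mulrA -expr2 exprVn sqr_sqrtr //.
    exact: ltW.
  under eq_bigr do rewrite MW normrM (gtr0_norm (_ : 0 < (d j)^-1)) ?invr_gt0 // Msym.
  by rewrite -mulr_suml ler_pdivrMr.
(* Write the basis vector as [sqrt (d i)] times its image under [W], and let [W] pass through the
   kernel, turning [X] into [Y]. *)
have vE : vec i = (o^-1 * Num.sqrt (d i)) *:
    (W *m (W *m (horner_mx Y (dirichlet l) *m delta_mx i ord0))).
  rewrite /vec /P [W *m (horner_mx _ _ *m _)]mulmxA (horner_mx_intertwine _ WY).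
  rewrite -scalemxAl -!mulmxA -!scalemxAr -scalerA; congr (_ *: _).
  rewrite !scalemxAr; congr (_ *m (_ *m _)).
  apply/matrixP => j q; rewrite ord1 mxE WE !mxE.
  case: (j =P i) => [->|_]; last by rewrite !mulr0.
  by rewrite mulKf // gt_eqF // sqrtr_gt0.
have WW (v : 'cV[R]_n.+1) : l1 (W *m (W *m v)) <= l1 v.
  apply: ler_sum => j _; rewrite !WE mulrA -expr2 exprVn sqr_sqrtr ?(ltW (d0 j)) //.
  rewrite normrM gtr0_norm ?invr_gt0 // ler_piMl // invf_le1 //.
rewrite vE l1Z exprMn real_normK ?num_real // exprMn exprVn sqr_sqrtr ?(ltW (d0 i)) //.
have hl : l1 (W *m (W *m (horner_mx Y (dirichlet l) *m delta_mx i ord0)))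
    <= 3 * 7 ^+ l.
  apply: (le_trans (WW _)); have := l1_dirichlet l (delta_mx i ord0) Y3.
  by rewrite l1_delta mulr1.
apply: ler_pM; rewrite ?sqr_ge0 //.
- by rewrite mulr_ge0 ?(ltW (d0 i)) // invr_ge0 sqr_ge0.
- by rewrite ler_piMl ?(ltW (d0 i)) // invf_le1 ?exprn_gt0 // expr_ge1 // ltW.
- by rewrite ler_sqr ?nnegrE ?l1_ge0 // (le_trans (l1_ge0 _) hl).
Qed.

Variable delta : R.
Hypotheses (delta0 : 0 < delta) (delta1 : delta * n.+1%:R <= n.+1%:R - (\rank B)%:R).
Hypothesis sumM : \sum_i \sum_j `|M i j| <= c * n.+1%:R.

(** Markov threshold: the average of [d] is at most 2, so at most a [delta / 4] share of the indices
    has [d i > t]. *)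
Let t := 8 / delta.
Let t0 : 0 < t. Proof. by rewrite divr_gt0. Qed.

Let sumd : \sum_i d i <= 2 * n.+1%:R.
Proof.
rewrite /d big_split /= sumr_const card_ord -mulr_suml.
have : (\sum_i \sum_j `|M i j|) / c <= n.+1%:R by rewrite ler_pdivrMr // mulrC.
by rewrite -mulr_natr mul1r; lra.
Qed.

Let bad_card : (#|[pred i | t < d i]|)%:R <= delta / 4 * n.+1%:R :> R.
Proof.
have : (#|[pred i | t < d i]|)%:R * t <= \sum_i d i.
  rewrite mulr_natl -sumr_const.
  apply: (@le_trans _ _ (\sum_(i | t < d i) d i)).
    by apply: ler_sum => i /ltW.
  by rewrite [leRHS](bigID (fun i => t < d i)) /= lerDl sumr_ge0 // => i _; exact: ltW.
move=> /le_trans /(_ sumd); rewrite -ler_pdivlMr // => /le_trans; apply.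
by rewrite /t le_eqVlt; apply/orP; left; apply/eqP; field; rewrite gt_eqF.
Qed.

(** Of the mass [sqn P], at least [delta] per coordinate, the bad rows and the bad columns each
    carry at most a quarter of [delta], as rows of [P] have norm at most 1. On the good block,
    symmetry of [P] averages the weight [d i / d j] with its inverse, and this mean is at least
    1. *)
Let mass_good : delta / 2 * n.+1%:R <= \sum_(i | d i <= t) d i * sqn (vec i).
Proof.
pose a i j : R := P j i ^+ 2.
have a0 i j : 0 <= a i j by exact: sqr_ge0.
have asym i j : a i j = a j i by rewrite /a -[in LHS]Psym [in LHS]mxE.
have gg : \sum_(i | d i <= t) \sum_(j | d j <= t) a i j <=
          \sum_(i | d i <= t) d i * sqn (vec i).
  apply: (@le_trans _ _
    (\sum_(i | d i <= t) \sum_(j | d j <= t) d i / d j * a i j)); last first.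
    apply: ler_sum => i _; rewrite sqn_vec mulr_sumr.
    rewrite [leRHS](bigID (fun j => d j <= t)) /=.
    rewrite -[leLHS]addr0 lerD //.
      by apply: ler_sum => j _; rewrite mulrAC mulrA.
    by apply: sumr_ge0 => j _; rewrite mulr_ge0 ?(ltW (d0 i)) // divr_ge0 ?sqr_ge0 ?(ltW (d0 j)).
  set S := \sum_(i | _) \sum_(j | _) d i / d j * a i j.
  have SE : S = \sum_(i | d i <= t) \sum_(j | d j <= t) d j / d i * a i j.
    rewrite /S exchange_big; apply: eq_bigr => i _; apply: eq_bigr => j _.
    by rewrite asym.
  suff : 2 * \sum_(i | d i <= t) \sum_(j | d j <= t) a i j <= S + S by lra.
  rewrite {2}SE /S -big_split mulr_sumr; apply: ler_sum => i _ /=.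
  rewrite -big_split mulr_sumr; apply: ler_sum => j _ /=.
  rewrite -mulrDl ler_wpM2r // -subr_ge0.
  have -> : d i / d j + d j / d i - 2 = (d i - d j) ^+ 2 / (d i * d j).
    by field; rewrite !gt_eqF.
  by rewrite divr_ge0 ?sqr_ge0 // mulr_ge0 ?(ltW (d0 _)).
apply: le_trans gg.
have row1 i : \sum_j a i j <= 1 by exact: colP.
have bad1 : \sum_(i | ~~ (d i <= t)) \sum_j a i j <= delta / 4 * n.+1%:R.
  apply: le_trans bad_card; rewrite -sumr_const.
  under eq_bigl do rewrite -ltNge.
  exact: ler_sum.
have bad2 : \sum_(i | d i <= t) \sum_(j | ~~ (d j <= t)) a i j <= delta / 4 * n.+1%:R.
  apply: le_trans bad1; rewrite exchange_big; apply: ler_sum => j _.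
  rewrite [leRHS](bigID (fun j => d j <= t)) /=.
  under eq_bigr do rewrite asym.
  by rewrite lerDl sumr_ge0.
have tot : \sum_i \sum_j a i j = sqn P by rewrite /sqn exchange_big.
have := sqnP; rewrite -tot (bigID (fun i => d i <= t)) /=.
under [X in _ <= X + _]eq_bigr do rewrite (bigID (fun j => d j <= t)) /=.
rewrite big_split /=.
move: delta1 bad1 bad2; lra.
Qed.

(** Apply the lower bound [Alow] to every [vec i] with [d i <= t], weight it by [d i], and sum. The
    three terms on the right bound the contributions of [B], of [C], and of the l1 norms. *)
Lemma rip_averaging (A C : 'M[R]_(m, n.+1)) (kappa : R) : 0 <= kappa ->
  (forall v : 'cV_n.+1, sqn (A *m v) = sqn (B *m v) + sqn (C *m v)) ->
  (forall v : 'cV_n.+1, sqn v <= 2 * sqn (A *m v) + kappa * l1 v ^+ 2) ->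
  delta / 2 * n.+1%:R <=
    4 * n.+1%:R * (c / l.*2.+1%:R ^+ 2) + 16 / delta * sqn C
      + kappa * (2 * n.+1%:R) * (8 / delta * (3 * 7 ^+ l) ^+ 2).
Proof.
move=> kappa0 AE Alow; apply: (le_trans mass_good).
have g0 (F : 'I_n.+1 -> R) b : (forall i, F i <= b) -> 0 <= b ->
    \sum_(i | d i <= t) d i * F i <= 2 * n.+1%:R * b.
  move=> Fb b0; apply: (@le_trans _ _ (\sum_(i | d i <= t) d i * b)).
    by apply: ler_sum => i _; rewrite ler_wpM2l // ltW.
  rewrite -mulr_suml ler_wpM2r //; apply: le_trans sumd.
  by rewrite [leRHS](bigID (fun i => d i <= t)) /= lerDl sumr_ge0 // => i _; exact: ltW.
have SB : \sum_(i | d i <= t) d i * sqn (B *m vec i) <= 2 * n.+1%:R * (c / o ^+ 2).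
  apply: g0 => [i|]; last by rewrite divr_ge0 ?sqr_ge0 ?(ltW c0).
  by rewrite /vec mulmxA (le_trans (EPle _)) // sqn_delta mulr1.
(* Here the weights are replaced by [t] and the sum is extended to all [i]. This gives the full
   squared norm of [C W P], and both [W] and [P] contract. *)
have SC : \sum_(i | d i <= t) d i * sqn (C *m vec i) <= t * sqn C.
  apply: (@le_trans _ _ (t * \sum_i sqn (C *m vec i))).
    rewrite mulr_sumr [leRHS](bigID (fun i => d i <= t)) /=.
    rewrite -[leLHS]addr0 lerD //.
      by apply: ler_sum => i dt; rewrite ler_wpM2r ?sqn_ge0.
    by apply: sumr_ge0 => i _; rewrite mulr_ge0 ?sqn_ge0 ?ltW.
  rewrite ler_wpM2l ?(ltW t0) //.
  have -> : \sum_i sqn (C *m vec i) = sqn (C *m (W *m P)).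
    by rewrite sqn_cols; apply: eq_bigr => i _; rewrite colE /vec !mulmxA.
  rewrite -sqn_tr !trmx_mul Psym Wtr -mulmxA (le_trans (Pcontr _)) //.
  rewrite -(sqn_tr C) /sqn; apply: ler_sum => j _; apply: ler_sum => q _.
  rewrite WE exprMn exprVn sqr_sqrtr ?(ltW (d0 j)) // ler_piMl ?sqr_ge0 //.
  by rewrite invf_le1.
have SL : \sum_(i | d i <= t) d i * l1 (vec i) ^+ 2 <=
    2 * n.+1%:R * (t * (3 * 7 ^+ l) ^+ 2).
  apply: (@le_trans _ _ (\sum_(i | d i <= t) d i * (t * (3 * 7 ^+ l) ^+ 2))).
    apply: ler_sum => i dt; rewrite ler_wpM2l ?(ltW (d0 i)) //.
    by rewrite (le_trans (l1_vec i)) // ler_wpM2r ?sqr_ge0.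
  by apply: g0 => //; rewrite mulr_ge0 ?sqr_ge0 ?(ltW t0).
have : \sum_(i | d i <= t) d i * sqn (vec i) <=
   2 * (\sum_(i | d i <= t) d i * sqn (B *m vec i) + \sum_(i | d i <= t) d i * sqn (C *m vec i))
   + kappa * \sum_(i | d i <= t) d i * l1 (vec i) ^+ 2.
  rewrite -big_split !mulr_sumr -big_split; apply: ler_sum => i _ /=.
  have := ler_wpM2l (ltW (d0 i)) (Alow (vec i)); rewrite AE; lra.
move=> /le_trans; apply; have := ler_wpM2l kappa0 SL; rewrite -/o.
have -> : 16 / delta = 2 * t by rewrite /t; ring.
rewrite -/t; move: SB SC; set z := (3 * 7 ^+ l) ^+ 2; set w := c / _.
clearbody t o z w; lra.
Qed.

End Averaging.

(** * The spread rows carry enough Frobenius mass *)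

Section SpreadRows.
Variable R : realType.

Lemma sqn_le_l1 n (u : 'cV[R]_n) : sqn u <= l1 u ^+ 2.
Proof.
rewrite sqn_cV expr2 {1}/l1 mulr_suml; apply: ler_sum => i _.
rewrite -(real_normK (num_real (u i ord0))) expr2 ler_wpM2l //.
by rewrite /l1 (bigD1 i) //= lerDl sumr_ge0.
Qed.

(** By the triangle inequality each row [b] contributes at most the sum of all [|B b i| * |B b j|],
    which is its squared l1 norm. *)
Lemma gram_l1_le m n (B : 'M[R]_(m, n)) (L : R) :
  (forall b, l1 (row b B)^T ^+ 2 <= L * sqn (row b B)) ->
  \sum_i \sum_j `|(B^T *m B) i j| <= L * sqn B.
Proof.
move=> BL; rewrite sqn_rows mulr_sumr.
apply: (@le_trans _ _ (\sum_b l1 (row b B)^T ^+ 2)); last exact: ler_sum.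
have -> : \sum_b l1 (row b B)^T ^+ 2 = \sum_i \sum_j \sum_b `|B b i| * `|B b j|.
  under [RHS]eq_bigr do rewrite exchange_big /=.
  rewrite exchange_big; apply: eq_bigr => b _ /=.
  rewrite expr2 {1}/l1 mulr_suml; apply: eq_bigr => i _.
  by rewrite mulr_sumr; apply: eq_bigr => j _; rewrite !mxE.
apply: ler_sum => i _; apply: ler_sum => j _; rewrite mxE.
apply: (le_trans (ler_norm_sum _ _ _)); apply: ler_sum => b _.
by rewrite mxE normrM.
Qed.

Lemma exp49_le_expR (l : nat) (x : R) : l%:R <= x -> 49 ^+ l <= expR (6 * x).
Proof.
move=> lx; have h6 : 49 <= expR 6 :> R.
  (* The Taylor term [6 ^ 5 / 5! = 64.8] alone exceeds 49. *)
  apply: (le_trans _ (expR_ge1Dxn 4 (ler0n R 6))).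
  have -> : 5`! = 120%N by [].
  lra.
apply: (@le_trans _ _ (expR 6 ^+ l)); first by rewrite lerXn2r ?nnegrE ?expR_ge0.
rewrite -expRM_natr ler_expR; lra.
Qed.

(** The other rows are zeroed rather than deleted, so that both restrictions keep the shape of [A],
    as [rip_averaging] requires. *)
Definition row_restrict m n (G : {pred 'I_m}) (A : 'M[R]_(m, n)) : 'M[R]_(m, n) :=
  \matrix_(i, j) (if i \in G then A i j else 0).

Lemma row_restrictE m n (G : {pred 'I_m}) (A : 'M[R]_(m, n)) :
  row_restrict G A = diag_mx (\row_i (i \in G)%:R) *m A.
Proof.
apply/matrixP => i j; rewrite mul_diag_mx !mxE.
by case: (i \in G); rewrite ?mul1r ?mul0r.
Qed.

Lemma sqn_row_restrict m n (G : {pred 'I_m}) (A : 'M[R]_(m, n)) :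
  sqn (row_restrict G A) = \sum_(i in G) sqn (row i A).
Proof.
rewrite sqn_rows [RHS]big_mkcond; apply: eq_bigr => i _.
rewrite {1}/sqn big_ord1; case: ifP => iG.
  by rewrite /sqn big_ord1; apply: eq_bigr => j _; rewrite !mxE iG.
by rewrite big1 // => j _; rewrite !mxE iG expr0n.
Qed.

Lemma sqn_restrict_split m n q (G : {pred 'I_m}) (A : 'M[R]_(m, n)) (V : 'M_(n, q)) :
  sqn (A *m V) = sqn (row_restrict [predC G] A *m V) + sqn (row_restrict G A *m V).
Proof.
rewrite !row_restrictE -!mulmxA -!row_restrictE !sqn_row_restrict sqn_rows.
by rewrite (bigID (mem G)) /= addrC.
Qed.

(** By contradiction: if the rows in [G] carry too little mass, all three terms on the right of
    [rip_averaging] are small, for [B] the rows outside [G] and [C] those inside. *)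
Lemma spread_rows_mass m n k (D L delta eta : R) (A : 'M[R]_(m, n)) (G : {set 'I_m}) :
  (0 < k)%N -> (k <= n)%N -> 1 <= D -> 0 < delta ->
  delta * n%:R = n%:R - (\rank A)%:R ->
  (forall x, (#|supp x| <= k)%N -> sqn (A *m x) <= D ^+ 2 * sqn x) ->
  (forall x, (#|supp x| <= k)%N -> sqn x <= sqn (A *m x)) ->
  0 < eta ->
  128 * D ^+ 8 / delta ^+ 4 <= n%:R `^ eta ->
  n%:R `^ eta <= 5760^-1 * k%:R ^+ 3 / (D ^+ 4 * n%:R ^+ 2) ->
  L = 100^-1 * (eta * Num.sqrt delta * ln n%:R / D ^+ 3) ->
  (forall i, i \notin G -> l1 (row i A)^T ^+ 2 <= L * sqn (row i A)) ->
  n%:R `^ (- eta) * sqn A <= \sum_(i in G) sqn (row i A).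
Proof.
case: n A => [|n] A k0 kn; first by case: k k0 kn.
move=> D1 delta0 deltaE Aup Alow eta0 hC1 hC2 LE Gc.
have D0 : 0 < D := lt_le_trans ltr01 D1.
have np : 0 < n.+1%:R :> R by rewrite ltr0n.
have kp : 0 < k%:R :> R by rewrite ltr0n.
have knR : k%:R <= n.+1%:R :> R by rewrite ler_nat.
have delta1 : delta <= 1.
  rewrite -(ler_pM2r np) mul1r deltaE lerBlDr lerDl; exact: ler0n.
set s := Num.sqrt delta in LE.
have s0 : 0 < s by rewrite sqrtr_gt0.
have s2 : s ^+ 2 = delta by rewrite sqr_sqrtr // ltW.
(* Chosen so that [expR (6 * x)] is the square root of [n ^ eta]. The degree [l] is the integer part
   of [x], and then [49 ^ l] is at most this root. *)
pose x := eta * ln n.+1%:R / 12.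
have LE2 : L * D ^+ 3 = 3 / 25 * (x * s).
  rewrite LE /x; field; rewrite gt_eqF //.
rewrite powRN; set y := n.+1%:R `^ eta in hC1 hC2 *.
have y128 : 128 <= y.
  apply: le_trans hC1; rewrite ler_pdivlMr ?exprn_gt0 // ler_pM2l //.
  apply: (@le_trans _ _ 1); last by rewrite expr_ge1 // ltW.
  by rewrite expr_le1 // ltW.
have y0 : 0 < y by apply: lt_le_trans y128.
have xge0 : 0 <= x.
  rewrite /x divr_ge0 // mulr_ge0 ?(ltW eta0) // ln_ge0 // ler1n //.
(* The threshold is [64 * 3 / 25]: above it, [c <= delta * x ^ 2 / 64]. Below it,
   [L * D ^ 4 < 576 / 625]. *)
have [small|large] := ltP (D * s * x) (192 / 25).
  (* here [L < 1], and a row outside [G] must vanish *)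
  have L1 : L < 1.
    rewrite -(ltr_pM2r (exprn_gt0 4 D0)) mul1r.
    have -> : L * D ^+ 4 = D * (L * D ^+ 3) by ring.
    rewrite LE2; apply: lt_le_trans (_ : 1 <= _); first lra.
    by rewrite expr_ge1 // ltW.
  have -> : \sum_(i in G) sqn (row i A) = sqn A.
    rewrite sqn_rows [RHS](bigID (mem G)) /= [X in _ + X]big1 ?addr0 // => i iG.
    apply/eqP; rewrite eq_le sqn_ge0 andbT.
    have := le_trans (sqn_le_l1 _) (Gc i iG); rewrite sqn_tr => h.
    by rewrite -(@ler_pM2l _ (1 - L)) ?subr_gt0 // mulr0 mulrBl mul1r subr_le0.
  by rewrite ler_piMl ?sqn_ge0 // invf_le1 //; lra.
rewrite leNgt; apply/negP => GA.
have x0 : 0 < x.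
  rewrite lt_def xge0 andbT; apply: contraL large => /eqP ->.
  by rewrite mulr0 -ltNge; lra.
have Lp : 0 < L.
  rewrite -(pmulr_lgt0 _ (exprn_gt0 3 D0)) LE2.
  by apply: mulr_gt0; [lra|exact: mulr_gt0].
set c := L * D ^+ 2.
have c0 : 0 < c by rewrite mulr_gt0 // exprn_gt0.
pose l := Num.trunc x.
have /andP[lx xl] : l%:R <= x < l.+1%:R by exact: truncn_itv.
have z0 : 0 < expR (6 * x) := expR_gt0 _.
have zy : expR (6 * x) ^+ 2 = y.
  rewrite /y /powR pnatr_eq0 -expRM_natr /x /=; congr expR; lra.
pose B := row_restrict [predC G] A.
pose C := row_restrict (mem G) A.
have sC : sqn C = \sum_(i in G) sqn (row i A) by rewrite sqn_row_restrict.
have AE q (V : 'M_(n.+1, q)) : sqn (A *m V) = sqn (B *m V) + sqn (C *m V).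
  exact: sqn_restrict_split.
have sB : sqn B <= D ^+ 2 * n.+1%:R.
  apply: le_trans (rip_sqn_le k0 Aup).
  by have := AE _ 1%:M; rewrite !mulmx1 => ->; rewrite lerDl sqn_ge0.
have rkB : (\rank B)%:R <= (\rank A)%:R :> R.
  by rewrite ler_nat /B row_restrictE mxrankM_maxr.
have sumM : \sum_i \sum_j `|(B^T *m B) i j| <= c * n.+1%:R.
  apply: (@le_trans _ _ (L * sqn B)); last by rewrite /c -mulrA ler_pM2l.
  apply: gram_l1_le => b; have [bG|bG] := boolP (b \in G).
    have -> : row b B = 0 by apply/rowP => j; rewrite !mxE inE bG.
    rewrite trmx0 /l1 big1 => [|i _]; last by rewrite mxE normr0.
    by rewrite expr0n mulr_ge0 ?sqn_ge0 ?(ltW Lp).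
  have -> : row b B = row b A by apply/rowP => j; rewrite !mxE inE bG.
  exact: Gc.
have key : delta / 2 * n.+1%:R <= 4 * n.+1%:R * (c / l.*2.+1%:R ^+ 2)
    + 16 / delta * sqn C
    + 5 * D ^+ 2 * n.+1%:R / k%:R ^+ 2 * (2 * n.+1%:R) * (8 / delta * (3 * 7 ^+ l) ^+ 2).
  have dB : delta * n.+1%:R <= n.+1%:R - (\rank B)%:R by rewrite deltaE lerB.
  have kap : 0 <= 5 * D ^+ 2 * n.+1%:R / k%:R ^+ 2 :> R.
    by rewrite divr_ge0 ?exprn_ge0 // mulr_ge0 // mulr_ge0 // sqr_ge0.
  have low := rip_l1_lower k0 kn Aup Alow D1.
  exact: (rip_averaging l c0 delta0 dB sumM kap (fun v => AE _ v) low).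
have o0 : 0 < l.*2.+1%:R :> R by rewrite ltr0n.
(* This uses [x < l + 1 <= 2 l + 1]. *)
have h1 : c / l.*2.+1%:R ^+ 2 <= delta / 64.
  rewrite ler_pdivrMr ?exprn_gt0 //.
  apply: (@le_trans _ _ (delta / 64 * x ^+ 2)); last first.
    rewrite ler_pM2l ?divr_gt0 // lerXn2r ?nnegrE ?(ltW x0) ?(ltW o0) //.
    by rewrite (le_trans (ltW xl)) // ler_nat ltnS -addnn leq_addr.
  have cD : c * D = 3 / 25 * (x * s) by rewrite -LE2 /c; ring.
  rewrite -(ler_pM2r D0) cD -s2.
  have := ler_wpM2l (ltW (mulr_gt0 x0 s0)) large; lra.
have D8 : 1 <= D ^+ 8 by rewrite expr_ge1 // ltW.
have D2 : 1 <= D ^+ 2 by rewrite expr_ge1 // ltW.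
have dy : 128 * D ^+ 8 <= delta ^+ 4 * y.
  by move: hC1; rewrite ler_pdivrMr ?exprn_gt0 // [y * _]mulrC.
(* The square root of [1 <= delta ^ 4 * n ^ eta], which is a weak form of [hC1]. *)
have dz : 1 <= delta ^+ 2 * expR (6 * x).
  have p0 : 0 <= delta ^+ 2 * expR (6 * x) by rewrite mulr_ge0 // ltW // exprn_gt0.
  rewrite -(@ler_sqr _ 1) ?nnegrE //.
  by rewrite expr1n exprMn zy -exprM; apply: le_trans dy; lra.
have h2 : 16 / delta * sqn C <= delta / 8 * n.+1%:R.
  have sC1 : sqn C * y <= D ^+ 2 * n.+1%:R.
    apply: le_trans (rip_sqn_le k0 Aup).
    by rewrite sC -ler_pdivlMr // mulrC ltW.
  have dy2 : 128 * D ^+ 2 <= delta ^+ 2 * y.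
    apply: (@le_trans _ _ (128 * D ^+ 8)); first by rewrite ler_pM2l // ler_weXn2l.
    by apply: (le_trans dy); rewrite ler_pM2r // ler_wiXn2l // ltW.
  rewrite mulrAC ler_pdivrMr // -(ler_pM2r y0).
  have := ler_wpM2r (ltW np) dy2; lra.
(* The constant [5760 = 5 * 2 * 8 * 9 * 8] collects the numerical factors of both sides. One factor
   [k] of [k ^ 3] in [hC2] is traded for [n]. *)
have h3 : 5 * D ^+ 2 * n.+1%:R / k%:R ^+ 2 * (2 * n.+1%:R) *
    (8 / delta * (3 * 7 ^+ l) ^+ 2) <= delta / 8 * n.+1%:R.
  have yk : 5760 * y * D ^+ 4 * n.+1%:R <= k%:R ^+ 2.
    rewrite -(ler_pM2r np); apply: (@le_trans _ _ (k%:R ^+ 3)); last first.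
      by rewrite exprSr ler_wpM2l ?exprn_ge0.
    move: hC2; rewrite ler_pdivlMr ?mulr_gt0 ?exprn_gt0 //; lra.
  have lz : 49 ^+ l <= expR (6 * x) by exact: exp49_le_expR.
  have ek : 5760 * D ^+ 2 * n.+1%:R * 49 ^+ l <= delta ^+ 2 * k%:R ^+ 2.
    apply: le_trans (ler_wpM2l (sqr_ge0 delta) yk).
    have -> : delta ^+ 2 * (5760 * y * D ^+ 4 * n.+1%:R) =
      5760 * D ^+ 2 * n.+1%:R * (D ^+ 2 * (delta ^+ 2 * expR (6 * x)) * expR (6 * x)).
      by rewrite -zy; ring.
    rewrite ler_pM2l ?mulr_gt0 ?exprn_gt0 //; apply: (le_trans lz).
    by apply: ler_peMl; [exact: ltW | exact: mulr_ege1].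
  have -> : 5 * D ^+ 2 * n.+1%:R / k%:R ^+ 2 * (2 * n.+1%:R) *
    (8 / delta * (3 * 7 ^+ l) ^+ 2) =
    5760 * D ^+ 2 * n.+1%:R * 49 ^+ l * (n.+1%:R / (8 * delta * k%:R ^+ 2)).
    have -> : 49 = 7 ^+ 2 :> R by ring.
    by rewrite -exprM mulnC exprM; field; rewrite !gt_eqF.
  have -> : delta / 8 * n.+1%:R =
    delta ^+ 2 * k%:R ^+ 2 * (n.+1%:R / (8 * delta * k%:R ^+ 2)).
    by field; rewrite !gt_eqF.
  by rewrite ler_wpM2r // divr_ge0 // !mulr_ge0 ?(ltW delta0) ?exprn_ge0.
(* The three terms are at most [1 / 16], [1 / 8] and [1 / 8] of [delta * n], and their sum stays
   below the required [1 / 2]. *)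
have := mulr_gt0 delta0 np.
have := ler_wpM2l (ltW np) h1.
move: key h2 h3; set p := c / _; set q := _ / _ * sqn C; set r := _ * (_ * _ ^+ 2).
clearbody p q r; lra.
Qed.

End SpreadRows.

(** * Translation between the stated notions and squared norms *)

Section Reduction.
Variable R : realType.

Lemma lpnorm2E n (x : 'cV[R]_n) : lpnorm 2 x = Num.sqrt (sqn x).
Proof.
rewrite /lpnorm -powR12_sqrt ?sqn_ge0 // sqn_cV; congr (_ `^ _).
apply: eq_bigr => i _; rewrite -[2]/(2%:R) powR_mulrn //.
by rewrite real_normK // num_real.
Qed.

Lemma lpnorm1E n (x : 'cV[R]_n) : lpnorm 1 x = l1 x.
Proof.
rewrite /lpnorm invr1 powRr1; last by apply: sumr_ge0 => i _; exact: powR_ge0.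
by apply: eq_bigr => i _; rewrite powRr1.
Qed.

Lemma frobenius_normE m n (A : 'M[R]_(m, n)) : frobenius_norm A ^+ 2 = sqn A.
Proof. by rewrite /frobenius_norm sqr_sqrtr // sqn_ge0. Qed.

Lemma sparse_nat n k (x : 'cV[R]_n) : sparse k%:R x <-> (#|supp x| <= k)%N.
Proof. by rewrite /sparse ler_nat. Qed.

Lemma lpRIP_scaled m n k (D : R) (A : 'M[R]_(m, n)) : 1 <= D -> lpRIP 2 k D A ->
  exists2 K : R, 0 < K &
    (forall x, (#|supp x| <= k)%N -> sqn (K^-1 *: A *m x) <= D ^+ 2 * sqn x) /\
    (forall x, (#|supp x| <= k)%N -> sqn x <= sqn (K^-1 *: A *m x)).
Proof.
move=> D1 [K K0 rip]; exists K => //.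
have D0 : 0 <= D by apply: le_trans D1.
have bounds x : (#|supp x| <= k)%N ->
    K ^+ 2 * sqn x <= sqn (A *m x) <= (D * K) ^+ 2 * sqn x.
  move=> /sparse_nat /rip; rewrite !lpnorm2E.
  have p0 (z : R) (a : R) : 0 <= a -> a * Num.sqrt z \is Num.nneg.
    by move=> a0; rewrite nnegrE mulr_ge0 // sqrtr_ge0.
  have s0 (z : R) : Num.sqrt z \is Num.nneg by rewrite nnegrE sqrtr_ge0.
  rewrite -(ler_sqr (p0 _ _ (ltW K0)) (s0 _)).
  rewrite -(ler_sqr (s0 _) (p0 _ _ (mulr_ge0 D0 (ltW K0)))).
  by rewrite ![(_ * Num.sqrt _) ^+ 2]exprMn !sqr_sqrtr ?sqn_ge0.
split=> x /bounds /andP[lo up]; rewrite -scalemxAl sqnZ exprVn.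
  by rewrite ler_pdivrMl ?exprn_gt0 // mulrA -exprMn [K * D]mulrC.
by rewrite ler_pdivlMl ?exprn_gt0.
Qed.

(** If a sparse [y] were that close, Cauchy-Schwarz on the support of [y] and on its complement
    would bound each part of [l1 x] by the root of [s * sqn x]. Then [l1 x ^ 2 <= 4 s * sqn x], and
    the constant 5 leaves room for strictness. *)
Lemma far_from_sparse_of_l1 n (L s : R) (x : 'cV[R]_n) : x != 0 -> 0 < s ->
  5 * s <= L -> L * sqn x <= l1 x ^+ 2 ->
  far_from_sparse (Num.sqrt (s / n%:R)) s x.
Proof.
move=> xn0 s0 sL Lx y ys; rewrite ltNge; apply/negP.
have x0 : 0 < sqn x by rewrite lt_def sqn_eq0 xn0 sqn_ge0.
have n0 : 0 < n%:R :> R.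
  rewrite ltr0n lt0n; apply: contraNneq xn0 => n0.
  by apply/eqP/matrixP => i; have := ltn_ord i; rewrite [X in (_ < X)%N]n0.
rewrite !lpnorm2E -sqrtrM ?divr_ge0 ?(ltW s0) //.
rewrite ler_sqrt; last by rewrite mulr_ge0 ?sqn_ge0 // divr_ge0 ?(ltW s0).
move=> xy; pose S := [set i | y i ord0 != 0].
have inS : (\sum_(i in S) `|x i ord0|) ^+ 2 <= s * sqn x.
  apply: (le_trans (sum_sqr_le _ _)); apply: ler_pM => //.
    by apply: sumr_ge0 => i _; exact: sqr_ge0.
  rewrite sqn_cV [leRHS](bigID (mem S)) /=.
  under eq_bigr do rewrite real_normK ?num_real //.
  by rewrite lerDl sumr_ge0 // => i _; exact: sqr_ge0.
have outS : (\sum_(i in ~: S) `|x i ord0|) ^+ 2 <= s * sqn x.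
  apply: (le_trans (sum_sqr_le _ _)).
  apply: (@le_trans _ _ (n%:R * sqn (x - y))); last first.
    by rewrite mulrC -ler_pdivlMr // mulrAC.
  apply: ler_pM => //.
  - by apply: sumr_ge0 => i _; exact: sqr_ge0.
  - by rewrite ler_nat -[leqRHS]card_ord max_card.
  rewrite sqn_cV [leRHS](bigID (mem (~: S))) /= -[leLHS]addr0 lerD //; last first.
    by rewrite sumr_ge0 // => i _; exact: sqr_ge0.
  apply: ler_sum => i; rewrite !inE negbK => /eqP yi.
  by rewrite !mxE yi subr0 real_normK ?num_real.
have l1E : l1 x = \sum_(i in S) `|x i ord0| + \sum_(i in ~: S) `|x i ord0|.
  by rewrite /l1 (bigID (mem S)) /=; congr (_ + _); apply: eq_bigl => i; rewrite !inE.
have := le_trans (ler_wpM2r (ltW x0) sL) Lx; rewrite l1E.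
move: inS outS; set a := \sum_(i in S) _; set b := \sum_(i in ~: S) _.
move=> ha hb; have := sqr_ge0 (a - b); have := mulr_gt0 s0 x0.
by nra.
Qed.

(** The enumeration of [G] is a subsequence of the increasing list of all ordinals. *)
Lemma enum_val_homo m (G : {set 'I_m}) :
  {homo (fun i : 'I_#|G| => enum_val i) : i j / (i < j)%N}.
Proof.
move=> i j ij; rewrite /enum_val.
(* The default element inside [enum_val] depends on the index, so both sides are first given the
   same one. *)
set x0 := enum_default i; rewrite (set_nth_default x0 (enum_default j)) -?cardE //.
have srt : sorted ltn (map val (enum G)).
  apply: (subseq_sorted ltn_trans _ (iota_ltn_sorted 0 m)).
  rewrite -val_enum_ord map_subseq // enumT [enum G]/enum_mem; exact: filter_subseq.
have sz : (j < size (map val (enum G)))%N by rewrite size_map -cardE.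
have szi : (i < size (map val (enum G)))%N by rewrite size_map -cardE.
have := sorted_ltn_nth ltn_trans 0%N srt i j szi sz ij.
by rewrite !(nth_map x0) -?cardE.
Qed.


(** If [k] exceeded [n], every vector would be k-sparse and the lower bound would make [A]
    injective, against its rank. *)
Lemma rank_lt_sparsity m n k (A : 'M[R]_(m, n)) : (\rank A < n)%N ->
  (forall x, (#|supp x| <= k)%N -> sqn x <= sqn (A *m x)) -> (k <= n)%N.
Proof.
move=> rA low; rewrite leqNgt; apply/negP => nk.
have : row_free A^T -> False.
  by rewrite /row_free mxrank_tr => /eqP rn; rewrite rn ltnn in rA.
apply; apply: inj_row_free => v vA.
have Av : A *m v^T = 0 by apply: trmx_inj; rewrite trmx_mul trmxK vA trmx0.
have /low : (#|supp v^T| <= k)%N.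
  by apply: (leq_trans (max_card _)); rewrite card_ord ltnW.
have /eqP -> : sqn (A *m v^T) == 0 by rewrite sqn_eq0 Av.
rewrite sqn_tr => v0; apply/eqP; rewrite -sqn_eq0.
by rewrite eq_le v0 sqn_ge0.
Qed.

End Reduction.

Theorem theorem3 (R : realType) :
  exists C1 C2 c3 c4 c5 : R,
    [/\ 0 < C1, 0 < C2, 0 < c3, 0 < c4 & 0 < c5] /\
    forall (m n : nat) (A : 'M[R]_(m, n)) (alpha : R) (k : nat) (D eta : R),
      0 < alpha -> alpha < 1 ->
      (\rank A)%:R = alpha * n%:R ->
      (1 <= k)%N -> 1 <= D ->
      lpRIP 2 k D A ->
      0 < eta ->
      C1 * D ^+ 8 / (1 - alpha) ^+ 4 <= n%:R `^ eta ->
      n%:R `^ eta <= C2 * k%:R ^+ 3 / (D ^+ 4 * n%:R ^+ 2) ->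
      exists (t : nat) (f : 'I_t -> 'I_m),
        (t <= m)%N /\ {homo f : i j / (i < j)%N} /\
        let T := rowsub f A in
        [/\ frobenius_norm T ^+ 2 / frobenius_norm A ^+ 2 >= n%:R `^ (- eta),
            t%:R >= c3 * (k%:R ^+ 3 / (D ^+ 4 * n%:R `^ (2 + eta))),
            (forall i : 'I_t,
               row i T != 0 /\
               distortion12 (row i T)^T <=
                 c4 * Num.sqrt (D ^+ 3 * n%:R /
                                (eta * Num.sqrt (1 - alpha) * ln n%:R)))
          & exists2 s : R,
              s >= c5 * (eta * Num.sqrt (1 - alpha) * ln n%:R / D ^+ 3)
            & forall i : 'I_t,
                far_from_sparse (Num.sqrt (s / n%:R)) s (row i T)^T].
Proof.
(* The first two constants are those of [spread_rows_mass]. Next, [2^-1] undoes the factor 2 of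
   [rip_row_bound], 10 is the root of the 100 in [L], and [500 = 100 * 5] comes from [s = L / 5]. *)
exists 128, 5760^-1, 2^-1, 10, 500^-1; split; first by split; lra.
move=> m n A alpha k D eta alpha0 alpha1 rkA k0 D1 ripA eta0 hC1 hC2.
have [K K0 [Aup Alow]] := lpRIP_scaled D1 ripA.
set delta := 1 - alpha in hC1 *.
have delta0 : 0 < delta by rewrite subr_gt0.
have D0 : 0 < D := lt_le_trans ltr01 D1.
have y1 : 1 < n%:R `^ eta.
  apply: lt_le_trans hC1; apply: (@lt_le_trans _ _ 128); first lra.
  rewrite ler_pdivlMr ?exprn_gt0 // ler_pM2l //.
  apply: (@le_trans _ _ 1); last by rewrite expr_ge1 // ltW.
  by rewrite expr_le1 ?(ltW delta0) // lerBlDr lerDl ltW.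
(* For [n = 0] and [n = 1] the power [n ^ eta] is 0 and 1, against [y1]. *)
have n1 : (1 < n)%N.
  case: (n) y1 => [|[|//]]; first by rewrite powR0 ?gt_eqF // ltr10.
  by rewrite powR1 ltxx.
have np : 0 < n%:R :> R by rewrite ltr0n ltnW.
have kp : 0 < k%:R :> R by rewrite ltr0n.
have lnp : 0 < ln n%:R :> R by rewrite ln_gt0 // ltr1n.
pose A' := K^-1 *: A.
have rkA' : \rank A' = \rank A.
  by rewrite mxrank_scale_nz // invr_neq0 // gt_eqF.
have rk_lt : (\rank A' < n)%N by rewrite -(ltr_nat R) rkA' rkA gtr_pMl.
have kn : (k <= n)%N := rank_lt_sparsity rk_lt Alow.
set q := eta * Num.sqrt delta * ln n%:R.
have q0 : 0 < q by rewrite mulr_gt0 // mulr_gt0 // sqrtr_gt0.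
pose L := 100^-1 * (q / D ^+ 3).
have L0 : 0 < L by rewrite mulr_gt0 ?invr_gt0 // divr_gt0 // exprn_gt0.
(* Zero rows satisfy the second condition trivially, so they are excluded explicitly. They carry no
   mass and meet the l1 bound required outside [G]. *)
pose G := [set i | (row i A != 0) && (L * sqn (row i A) <= l1 (row i A)^T ^+ 2)].
have rowZ i : row i A' = K^-1 *: row i A by rewrite /A' linearZ.
have mass : n%:R `^ (- eta) * sqn A' <= \sum_(i in G) sqn (row i A').
  apply: (@spread_rows_mass _ m n k D L delta) => //.
  - by rewrite rkA' rkA /delta; ring.
  - move=> i; rewrite inE rowZ negb_and negbK -ltNge => h.
    rewrite linearZ /= l1Z sqnZ exprMn real_normK ?num_real // [leRHS]mulrCA.
    rewrite ler_wpM2l ?sqr_ge0 //; case/orP: h => [/eqP -> | /ltW //].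
    rewrite trmx0 /l1 big1 => [|j _]; last by rewrite mxE normr0.
    by rewrite expr0n mulr_ge0 ?sqn_ge0 ?(ltW L0).
have massZ : \sum_(i in G) sqn (row i A') = K^-1 ^+ 2 * \sum_(i in G) sqn (row i A).
  by rewrite mulr_sumr; apply: eq_bigr => i _; rewrite rowZ sqnZ.
have sA'ge : n%:R <= sqn A' := rip_sqn_ge k0 Alow.
have Ki : 0 < K^-1 ^+ 2 by rewrite exprn_gt0 // invr_gt0.
have sA0 : 0 < sqn A.
  by have := lt_le_trans np sA'ge; rewrite /A' sqnZ pmulr_rgt0.
exists #|G|, (fun i => enum_val i); split.
  by rewrite -[leqRHS]card_ord max_card.
split; first exact: enum_val_homo.
move=> T.
have rowT i : row i T = row (enum_val i) A by rewrite row_rowsub.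
have sT : sqn T = \sum_(i in G) sqn (row i A).
  by rewrite sqn_rows [RHS]big_enum_val; apply: eq_bigr => i _; rewrite rowT.
have TG i : row i T != 0 /\ L * sqn (row i T) <= l1 (row i T)^T ^+ 2.
  by have := enum_valP i; rewrite inE -rowT => /andP[].
split.
- rewrite !frobenius_normE sT ler_pdivlMr //.
  by move: mass; rewrite massZ {1}/A' sqnZ mulrCA ler_pM2l.
(* Counting: the selected rows have total mass at least [n / n ^ eta], while each has mass at most
   [2 D ^ 2 n / k]. The stated bound then follows from [k <= n] and [1 <= D]. *)
- have upT : \sum_(i in G) sqn (row i A') <= #|G|%:R * (D ^+ 2 * (2 * n%:R / k%:R)).
    rewrite mulr_natl -sumr_const; apply: ler_sum => i _.
    exact: (rip_row_bound k0 kn Aup).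
  have yp : 0 < n%:R `^ eta by apply: lt_trans y1.
  have e1 : n%:R `^ (2 + eta) = n%:R ^+ 2 * n%:R `^ eta :> R.
    by rewrite powRD ?(gt_eqF np) ?implybT // -[2]/(2%:R) powR_mulrn // ltW.
  have h : n%:R / n%:R `^ eta <= #|G|%:R * (D ^+ 2 * (2 * n%:R / k%:R)).
    apply: le_trans upT; apply: le_trans mass.
    by rewrite powRN mulrC ler_pM2l ?invr_gt0.
  rewrite e1; set y := n%:R `^ eta in yp h *.
  have h' : k%:R <= 2 * D ^+ 2 * y * #|G|%:R.
    move: h; rewrite ler_pdivrMr // => h.
    rewrite -(ler_pM2r np) -[leLHS]mulrC -ler_pdivlMr //.
    apply: (le_trans h); rewrite le_eqVlt; apply/orP; left; apply/eqP.
    by field; rewrite gt_eqF.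
  rewrite [leLHS]mulrA ler_pdivrMr; last by rewrite !mulr_gt0 ?exprn_gt0.
  have kn2 : k%:R ^+ 2 <= n%:R ^+ 2 :> R.
    by rewrite lerXn2r ?nnegrE ?ler_nat // ltW.
  have D24 : D ^+ 2 <= D ^+ 4 by rewrite ler_weXn2l.
  apply: (@le_trans _ _ (2^-1 * (n%:R ^+ 2 * (2 * D ^+ 2 * y * #|G|%:R)))).
    rewrite ler_pM2l ?invr_gt0 // exprSr; apply: ler_pM => //.
    by rewrite exprn_ge0.
  have -> : 2^-1 * (n%:R ^+ 2 * (2 * D ^+ 2 * y * #|G|%:R)) =
    D ^+ 2 * (n%:R ^+ 2 * y * #|G|%:R) by field.
  have -> : #|G|%:R * (D ^+ 4 * (n%:R ^+ 2 * y)) = D ^+ 4 * (n%:R ^+ 2 * y * #|G|%:R).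
    by ring.
  by rewrite ler_wpM2r // !mulr_ge0 ?exprn_ge0 // ltW.
- move=> i; have [r0 rL] := TG i; split=> //.
  set r := row i T in r0 rL *.
  have rT0 : 0 < sqn r by rewrite lt_def sqn_eq0 r0 sqn_ge0.
  have l10 : 0 < l1 r^T.
    rewrite lt_def; apply/andP; split; last exact: l1_ge0.
    apply: contraTneq rL => ->; rewrite expr0n -ltNge; exact: mulr_gt0.
  rewrite /distortion12 lpnorm2E lpnorm1E sqn_tr ler_pdivrMr //.
  rewrite -sqrtrM ?sqn_ge0 //.
  have -> : 10 = Num.sqrt (10 ^+ 2) :> R by rewrite sqrtr_sqr ger0_norm.
  rewrite -sqrtrM ?exprn_ge0 // -[l1 _]ger0_norm ?l1_ge0 // -sqrtr_sqr.
  have w0 : 0 <= 10 ^+ 2 * (D ^+ 3 * n%:R / q).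
    rewrite mulr_ge0 ?exprn_ge0 // divr_ge0 ?(ltW q0) //.
    by rewrite mulr_ge0 // exprn_ge0 // ltW.
  rewrite -sqrtrM //; apply: ler_wsqrtr.
  have <- : 10 ^+ 2 * (D ^+ 3 * n%:R / q) * (L * sqn r) = sqn r * n%:R.
    by rewrite /L; field; rewrite !gt_eqF.
  exact: ler_wpM2l.
- exists (L / 5).
    by rewrite /L le_eqVlt; apply/orP; left; apply/eqP; field; rewrite gt_eqF.
  move=> i; have [r0 rL] := TG i.
  apply: (@far_from_sparse_of_l1 _ _ L) => //.
  + by rewrite -trmx0 (inj_eq trmx_inj).
  + by rewrite divr_gt0.
  + lra.
  + by rewrite sqn_tr.
Qed.
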